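(* Let $F \in K[X,Y,Z,U,V]$ be a Perazzo form of degree $d \ge 5$ (so $V(F)\subset \mathbb{P}^4$ is a Perazzo hypersurface), let $A_F = R/\operatorname{Ann}_R F$ be the associated Artinian Gorenstein algebra, and let $(h_0,h_1,\ldots,h_d)$ be its Hilbert vector, $h_i=\dim_K (A_F)_i$. Then $A_F$ has the weak Lefschetz property if and only if $\#\{i \mid h_i=d+2\}\le 1$.
   Context: $K$ is an algebraically closed field of characteristic zero. A Perazzo form of degree $d$ in $K[X,Y,Z,U,V]$ is a homogeneous polynomial of degree $d$ of the form $F = Xp_0+Yp_1+Zp_2+G$ with $p_0,p_1,p_2\in K[U,V]_{d-1}$ linearly independent over $K$ (they are then automatically algebraically dependent) and $G\in K[U,V]_d$. The polynomial ring $R=K[x,y,z,u,v]$ acts on $K[X,Y,Z,U,V]$ by differentiation ($x=\partial/\partial X$, $y=\partial/\partial Y$, $z=\partial/\partial Z$, $u=\partial/\partial U$, $v=\partial/\partial V$); the action is written $p\circ F$. Put $\operatorname{Ann}_R F=\{p\in R \mid p\circ F=0\}$ and $A_F=R/\operatorname{Ann}_R F$, a standard graded Artinian Gorenstein $K$-algebra of socle degree $d$. A graded Artinian $K$-algebra $A$ has the weak Lefschetz property (WLP) if there is a linear form $\ell\in A_1$ such that for every $i\ge 0$ the multiplication map $\times\ell: A_i\to A_{i+1}$ has maximal rank (is injective or surjective). *)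

(* Defs.v *)
From HB Require Import structures.
From mathcomp Require Import all_boot all_order all_algebra all_field.
From mathcomp Require Import generic_quotient ring_quotient.
From mathcomp Require Import ssrcomplements freeg mpoly.

Set Implicit Arguments.
Unset Strict Implicit.
Unset Printing Implicit Defensive.

Import GRing.Theory.

Local Open Scope ring_scope.
Local Open Scope quotient_scope.

(* Weak Lefschetz property of the algebra A = \bigoplus_i gr i. *)
Definition WLP (K : fieldType) (A : falgType K) (gr : nat -> {vspace A}) :=
  exists2 l : A, l \in gr 1 &
    forall i : nat,
      {in gr i &, injective (fun a => l * a)} \/
      {in gr i.+1, forall b, exists2 a, a \in gr i & l * a = b}.

(* A space lying between 'rV_s ->> V and V >-> 'rV_t is finite dimensional. *)
Lemma vector_axiom_factor (K : fieldType) (V : lmodType K) (s t : nat)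
    (psi : {linear 'rV[K]_s -> V}) (phi : {linear V -> 'rV[K]_t}) :
    (forall a, exists w, psi w = a) -> injective phi ->
  Vector.axiom (\rank (lin1_mx (phi \o psi))) V.
Proof.
move=> psi_surj phi_inj; set M := lin1_mx _.
have phi_psi w : phi (psi w) = w *m M by rewrite mul_rV_lin1.
pose r2v r := psi (r *m row_base M *m pinvmx M).
exists (fun a => phi a *m pinvmx (row_base M)).
  by move=> c a b; rewrite linearP mulmxDl scalemxAl.
exists r2v => [a|r].
  have [w <-] := psi_surj a; apply: phi_inj.
  have sub_wM: (w *m M <= row_base M)%MS by rewrite eq_row_base submxMl.
  by rewrite /r2v mulmxKpV phi_psi ?mulmxKpV // phi_psi ?submxMl.
have sub_rM: (r *m row_base M <= M)%MS.
  by rewrite (submx_trans (submxMl _ _)) ?eq_row_base.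
by rewrite /r2v phi_psi (mulmxKpV sub_rM) mulmxKp ?row_base_free.
Qed.

Section Action.

Variables (K : fieldType) (n : nat).
Implicit Types p q F : {mpoly K[n]}.

(* mact F p is p \o F, the variables of p acting as partial derivatives. *)
Definition mact F p : {mpoly K[n]} := \sum_(m <- msupp p) p@_m *: F^`M[m].

Lemma mactwE k p F : (msize p <= k)%N ->
  mact F p = \sum_(m : 'X_{1..n < k}) p@_m *: F^`M[m].
Proof.
move=> le_pk; rewrite /mact (big_mksub 'X_{1..n < k}) //=; first last.
- by move=> m /msize_mdeg_lt/leq_trans; apply.
- exact: msupp_uniq.
rewrite big_rmcond //= => m; rewrite -mcoeff_eq0 => /eqP->.
by rewrite scale0r.
Qed.

Lemma mact_is_linear F : linear (mact F).
Proof.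
move=> c p q /=; pose k := maxn (msize (c *: p + q)) (maxn (msize p) (msize q)).
rewrite !(@mactwE k) ?leq_max ?leqnn ?orbT // scaler_sumr -big_split /=.
by apply: eq_bigr => m _; rewrite mcoeffD mcoeffZ scalerDl scalerA.
Qed.

HB.instance Definition _ F :=
  GRing.isLinear.Build K {mpoly K[n]} {mpoly K[n]} _ (mact F)
    (mact_is_linear F).

Lemma mactZ F c p : mact F (c *: p) = c *: mact F p.
Proof. exact: linearZ_LR. Qed.

Lemma mactX m F : mact F 'X_[m] = F^`M[m].
Proof. by rewrite /mact msuppX big_seq1 mcoeffX eqxx scale1r. Qed.

Lemma mact1 F : mact F 1 = F.
Proof. by rewrite -mpolyX0 mactX mderivm0m. Qed.

Lemma mactZr p c F : mact (c *: F) p = c *: mact F p.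
Proof.
rewrite /mact scaler_sumr; apply: eq_bigr => m _.
by rewrite mderivmZ !scalerA mulrC.
Qed.

Lemma mact0r p : mact 0 p = 0.
Proof. by rewrite /mact big1 // => m _; rewrite linear0 scaler0. Qed.

Lemma mact_sumr p (I : Type) (r : seq I) (G : I -> {mpoly K[n]}) :
  mact (\sum_(i <- r) G i) p = \sum_(i <- r) mact (G i) p.
Proof.
rewrite /mact exchange_big /=; apply: eq_bigr => m _.
by rewrite linear_sum scaler_sumr.
Qed.

Lemma mactM p q F : mact F (p * q) = mact (mact F q) p.
Proof.
rewrite {1}(mpolyE p) {1}(mpolyE q) mulr_suml (linear_sum (mact F)) /=.
rewrite [RHS]/mact; apply: eq_bigr => m _.
rewrite -scalerAl mactZ mulr_sumr.
rewrite (linear_sum (mact F)) [X in _ = _ *: X^`M[m]]/mact (linear_sum (mderivm m)) /=.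
congr (_ *: _); apply: eq_bigr => m' _.
rewrite -scalerAr mactZ -mpolyXD mactX mderivmZ.
by rewrite addmC mderivmDm.
Qed.

Lemma mactX_eq0 m F : (msize F <= mdeg m)%N -> mact F 'X_[m] = 0.
Proof.
move=> leFm; apply/mpolyP => m'; rewrite mactX mcoeff_mderivm mcoeff0.
by rewrite memN_msupp_eq0 ?mul0rn ?msize_mdeg_ge // mdegD (leq_trans leFm) ?leq_addr.
Qed.

Lemma mcoeff_mact_eq0 p m F : (msize F <= mdeg m)%N -> (mact F p)@_m = 0.
Proof.
move=> leFm; rewrite /mact linear_sum big1_seq //= => m' _.
rewrite mcoeffZ mcoeff_mderivm [F@_(_)]memN_msupp_eq0 ?mul0rn ?mulr0 //.
by rewrite msize_mdeg_ge // mdegD (leq_trans leFm) ?leq_addl.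
Qed.

Definition Ann F : {pred {mpoly K[n]}} := [pred p | mact F p == 0].

Lemma Ann_idealr_closed F : F != 0 -> idealr_closed (Ann F).
Proof.
move=> nzF; split; rewrite ?inE ?mact1 //; first by rewrite (linear0 (mact F)).
move=> a p q; rewrite !inE => /eqP p0 /eqP q0.
by rewrite (linearD (mact F)) /= mactM p0 mact0r q0 addr0.
Qed.

End Action.

(* The ring quotients of the library are nonzero, whence the requirement that *)
(* F != 0 (i.e. that Ann F be a proper ideal).                                *)
Section MacaulayDual.

Variables (K : fieldType) (n : nat) (F : {mpoly K[n]}) (nzF : F != 0).

Definition AnnI : idealr {mpoly K[n]} :=
  HB.pack (Ann F : {mpoly K[n]} -> bool)
    (isIdealr.Build _ _ (Ann_idealr_closed nzF)).

Definition AF := {ideal_quot AnnI}.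

HB.instance Definition _ := GRing.ComNzRing.on AF.
HB.instance Definition _ := EqQuotient.on AF.

Definition piAF (p : {mpoly K[n]}) : AF := \pi_{ideal_quot AnnI} p.

Lemma piAF_eq p q : (piAF p == piAF q) = (mact F (p - q) == 0).
Proof. by rewrite /piAF -Quotient.idealrBE. Qed.

Lemma piAFD p q : piAF (p + q) = piAF p + piAF q.
Proof. exact: (rmorphD (\pi_{ideal_quot AnnI})). Qed.

Lemma piAFM p q : piAF (p * q) = piAF p * piAF q.
Proof. exact: (rmorphM (\pi_{ideal_quot AnnI})). Qed.

Lemma piAF1 : piAF 1 = 1.
Proof. exact: (rmorph1 (\pi_{ideal_quot AnnI})). Qed.

Definition scaleAF (c : K) (a : AF) : AF := piAF c%:MP * a.

Lemma scaleAFA c1 c2 a : scaleAF c1 (scaleAF c2 a) = scaleAF (c1 * c2) a.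
Proof. by rewrite /scaleAF mulrA -piAFM -mpolyCM. Qed.

Lemma scaleAF1 : left_id 1 scaleAF.
Proof. by move=> a; rewrite /scaleAF piAF1 mul1r. Qed.

Lemma scaleAFDr : right_distributive scaleAF +%R.
Proof. by move=> c a b; rewrite /scaleAF mulrDr. Qed.

Lemma scaleAFDl a : {morph scaleAF^~ a : c1 c2 / c1 + c2}.
Proof. by move=> c1 c2; rewrite /scaleAF mpolyCD piAFD mulrDl. Qed.

HB.instance Definition _ :=
  GRing.Zmodule_isLmodule.Build K AF scaleAFA scaleAF1 scaleAFDr scaleAFDl.

Lemma scaleAFAl c (a b : AF) : c *: (a * b) = c *: a * b.
Proof. exact: mulrA. Qed.

HB.instance Definition _ := GRing.Lmodule_isLalgebra.Build K AF scaleAFAl.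
HB.instance Definition _ := GRing.Lalgebra_isComAlgebra.Build K AF.

Lemma piAF_is_linear : linear piAF.
Proof. by move=> c p q; rewrite piAFD -mul_mpolyC piAFM. Qed.

HB.instance Definition _ :=
  GRing.isLinear.Build K {mpoly K[n]} AF _ piAF piAF_is_linear.

Let k := msize F.
Let N := #|{: 'X_{1..n < k}}|.

Let psi (w : 'rV[K]_N) : AF :=
  \sum_(i < N) w 0 i *: piAF 'X_[(enum_val i : 'X_{1..n < k})].

Fact psi_is_linear : linear psi.
Proof.
move=> c w1 w2; rewrite /psi scaler_sumr -big_split /=.
by apply: eq_bigr => i _; rewrite !mxE scalerDl scalerA.
Qed.

HB.instance Definition _ :=
  GRing.isLinear.Build K 'rV[K]_N AF _ psi psi_is_linear.

Let phi (a : AF) : 'rV[K]_N :=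
  \row_i (mact F (repr a))@_(enum_val i : 'X_{1..n < k}).

Fact phi_piAF p :
  phi (piAF p) = \row_i (mact F p)@_(enum_val i : 'X_{1..n < k}).
Proof.
apply/rowP => i; rewrite !mxE; congr (_@__).
apply/eqP; rewrite -subr_eq0 -(linearB (mact F)) /= -piAF_eq.
by rewrite /piAF reprK.
Qed.

Fact phi_is_linear : linear phi.
Proof.
move=> c a b; rewrite -[a]reprK -[b]reprK -!/(piAF _) -linearP !phi_piAF.
by apply/rowP => i; rewrite !mxE (linearD (mact F)) /= mactZ mcoeffD mcoeffZ.
Qed.

HB.instance Definition _ :=
  GRing.isLinear.Build K AF 'rV[K]_N _ phi phi_is_linear.

Fact psi_surj a : exists w, psi w = a.
Proof.
exists (\row_i (repr a)@_(enum_val i : 'X_{1..n < k})).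
rewrite -[RHS]reprK -/(piAF _); set p := repr a.
pose l := maxn k (msize p).
rewrite [in RHS](@mpolywE _ _ l p) ?leq_maxr // linear_sum /=.
rewrite /psi; under [LHS]eq_bigr do rewrite mxE.
transitivity (\sum_(m : 'X_{1..n < k}) p@_m *: piAF 'X_[m]).
  rewrite [RHS](reindex_onto (enum_val (A := predT)) enum_rank) /=; last first.
    by move=> m _; rewrite enum_rankK.
  by apply: eq_big => // i; rewrite enum_valK eqxx.
under [RHS]eq_bigr do rewrite linearZ /=.
apply: (eq_big_widen _ _ (P := predT) (F := fun m => p@_m *: piAF 'X_[m])).
  by move=> m /leq_trans; apply; rewrite leq_maxl.
move=> m; rewrite -leqNgt => /mactX_eq0 m0.
suff /eqP-> : piAF 'X_[m] == piAF 0 by rewrite linear0 scaler0.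
by rewrite piAF_eq subr0 m0.
Qed.

Fact phi_inj : injective phi.
Proof.
apply: raddf_inj => a; rewrite -[a]reprK -/(piAF _); set p := repr a.
rewrite /= phi_piAF => /rowP p0; apply/eqP; rewrite -(linear0 piAF) piAF_eq subr0.
apply/eqP/mpolyP => m; rewrite mcoeff0.
have [ltmk|/mcoeff_mact_eq0//] := ltnP (mdeg m) k.
by have := p0 (enum_rank (BMultinom ltmk)); rewrite !mxE enum_rankK.
Qed.

HB.instance Definition _ :=
  Lmodule_hasFinDim.Build K AF (vector_axiom_factor psi_surj phi_inj).
HB.instance Definition _ := Algebra_isFalgebra.Build K AF.

End MacaulayDual.

(* (A_F)_i, the image in A_F of the forms of degree i. *)
Definition gradAF (K : fieldType) (n : nat) (F : {mpoly K[n.+1]})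
    (nzF : F != 0) (i : nat) : {vspace AF nzF} :=
  limg (linfun (fun p : dhomog n.+1 K i => piAF nzF p)).

Lemma mem_gradAF (K : fieldType) (n : nat) (F : {mpoly K[n.+1]})
    (nzF : F != 0) (i : nat) (a : AF nzF) :
  a \in gradAF nzF i <->
  exists2 p : {mpoly K[n.+1]}, p \is i.-homog & piAF nzF p = a.
Proof.
pose f (p : dhomog n.+1 K i) := piAF nzF p.
have f_linear : linear f by move=> c p q; rewrite /f !linearP.
pose fL := HB.pack_for {linear dhomog n.+1 K i -> AF nzF} f
  (GRing.isLinear.Build K (dhomog n.+1 K i) (AF nzF) _ f f_linear).
split=> [/memv_imgP[p _ ->]|[p p_hom <-]].
  by exists p; [exact: (valP p) | rewrite (lfunE fL)].
apply/memv_imgP; exists (DHomog p_hom); first exact: memvf.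
by rewrite (lfunE fL).
Qed.

Section Perazzo.

Variable K : fieldType.

Notation varX := ('X_(@Ordinal 5 0 isT) : {mpoly K[5]}).
Notation varY := ('X_(@Ordinal 5 1 isT) : {mpoly K[5]}).
Notation varZ := ('X_(@Ordinal 5 2 isT) : {mpoly K[5]}).
Notation varU := ('X_(@Ordinal 5 3 isT) : {mpoly K[5]}).
Notation varV := ('X_(@Ordinal 5 4 isT) : {mpoly K[5]}).

(* The embedding of K[U,V] into K[X,Y,Z,U,V]. *)
Definition inUV (p : {mpoly K[2]}) : {mpoly K[5]} := p \mPo [tuple varU; varV].

Definition perazzo (d : nat) (F : {mpoly K[5]}) : Prop :=
  exists p0 p1 p2 G : {mpoly K[2]},
    [/\ [/\ p0 \is d.-1.-homog, p1 \is d.-1.-homog & p2 \is d.-1.-homog],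
        forall a b c : K, a *: p0 + b *: p1 + c *: p2 = 0 ->
          [/\ a = 0, b = 0 & c = 0],
        G \is d.-homog &
        F = varX * inUV p0 + varY * inUV p1 + varZ * inUV p2 + inUV G].

Lemma perazzo_neq0 d F : perazzo d F -> F != 0.
Proof.
case=> p0 [p1 [p2 [G [_ free_p _ ->]]]]; apply/eqP => F0.
pose ev (c : K) : 5.-tuple {mpoly K[2]} :=
  [tuple c%:MP; 0; 0; 'X_ord0; 'X_ord_max].
have inUVK c p : inUV p \mPo ev c = p.
  rewrite /inUV [p \mPo _]comp_mpolyE [RHS]mpolyE linear_sum /=.
  apply: eq_bigr => m _; rewrite comp_mpolyZ; congr (_ *: _).
  rewrite rmorph_prod [in RHS]mpolyXE_id /=; apply: eq_bigr => i _.
  rewrite rmorphXn /=; congr (_ ^+ _).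
  by case: i => [[|[|//]] lti] /=; rewrite comp_mpolyXU;
    congr mpolyX; congr mnm1; apply: val_inj.
have evF c : c *: p0 + G = 0.
  have := congr1 (fun P => P \mPo ev c) F0.
  rewrite !rmorphD !rmorphM /= !inUVK !comp_mpolyXU /= comp_mpoly0.
  by rewrite !mul0r !addr0 mul_mpolyC.
have G0 : G = 0 by have := evF 0; rewrite scale0r add0r.
have p00 : p0 = 0 by have := evF 1; rewrite G0 scale1r addr0.
have [|/eqP] := free_p 1 0 0; first by rewrite p00 scaler0 !scale0r !addr0.
by rewrite oner_eq0.
Qed.

End Perazzo.

(* Main.v *)
(* Let S = K[u,v], let x_0, x_1, x_2 be the classes of x, y, z in A = A_F, so     *)
(* that x_k x_l = 0, and let I be the ideal of the forms of S killed by the x_k.  *)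
(* The pairing A_i x A_(d-i) -> K is perfect and the subspace (x) S_(i-1) of A_i  *)
(* only pairs with S_(d-i); hence h_i = d + 2 iff I_i = I_(d-i) = 0. With         *)
(* k = d./2, it follows that at most one h_i is d + 2 iff I_(k+1) <> 0.           *)
(* If I_(k+1) = 0, then multiplication by a linear form from degree d-k-1 to d-k  *)
(* maps (x) S_(d-k-2), of dimension k + 2, to (x) S_(d-k-1), of dimension k + 1;  *)
(* it is not injective although both h's are d + 2.                               *)
(* If I_(k+1) <> 0, let f be a form of least degree in I, let g be one in         *)
(* (0 : f^2), and let l in <u,v> divide neither. A Bezout argument shows that the *)
(* forms of I (resp. (0 : f^2)) up to the middle degree are multiples of f        *)
(* (resp. g). If a in A_i, i < d/2, has l a = 0, then its component in S_i is     *)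
(* f q with l f^2 q = 0, so g | q and f a = f^2 q = 0; as A_(d-i) is spanned by   *)
(* (x) and the multiples of l and f, this gives a = 0. Surjectivity in the upper  *)
(* half is dual. A form of degree n is encoded by its dehomogenization, with l at *)
(* infinity: multiplication by l does not change the polynomial, and l does not   *)
(* divide f iff the dehomogenization has size deg f + 1.                          *)

From HB Require Import structures.
Require Import Defs.
From mathcomp Require Import all_boot all_order all_algebra all_field.
From mathcomp Require Import generic_quotient zify ring.
From mathcomp Require Import mpoly.

Set Implicit Arguments.
Unset Strict Implicit.
Unset Printing Implicit Defensive.

Import GRing.Theory.
Local Open Scope ring_scope.

(** * Binary forms *)

(** All arguments take place in a [square_zero_ext]; [perazzo_ext] shows that A_F is one. By
    [dim_gr_max], h_i = d + 2 exactly when no binary form of degree i or d - i annihilates the x_k.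
    If there is none in degree d/2 + 1, two consecutive h's are d + 2 and [not_WLP] finds a kernel
    by counting dimensions inside (x). Otherwise [mulv_inj] shows that a general linear form v is
    injective below the middle. If v a = 0 and q is the binary part of a, then v q annihilates the
    x_k. By [ann_dvdp] such forms are multiples of one form f in low degrees, so q = f q2 and f a =
    f^2 q2; the same lemma for (0 : f^2) gives f a = 0. Then a pairs to zero with (x), with v and
    with f, which generate everything in the complementary degree. When d is odd, the degree bound
    of [ann_dvdp] can fail by one; [middle_dvdp] then uses the independence of the x_k. [WLP_of_inj]
    dualizes, and [shear_lead] provides v. *)

Section Homogenization.

Variables (K : fieldType).

Section Def.
Variables (B : algType K) (u w : B).
Implicit Types (n : nat) (p q : {poly K}).

(* The value at (u, w) of the binary form of degree n that dehomogenizes to p; *)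
(* the coefficients of p beyond n are ignored.                                 *)
Definition hform n p : B := \sum_(i < n.+1) p`_i *: (u ^+ i * w ^+ (n - i)).

Lemma hform_is_linear n : linear (hform n).
Proof.
move=> c p q; rewrite /hform scaler_sumr -big_split /=; apply: eq_bigr => i _.
by rewrite coefD coefZ scalerDl scalerA.
Qed.

HB.instance Definition _ n :=
  GRing.isLinear.Build K {poly K} B _ (hform n) (hform_is_linear n).

Lemma hformXn n i : (i <= n)%N -> hform n 'X^i = u ^+ i * w ^+ (n - i).
Proof.
rewrite -ltnS => lt_in; rewrite /hform (bigD1 (Ordinal lt_in)) //=.
rewrite coefXn eqxx scale1r big1 ?addr0 // => j neq_ji.
by rewrite coefXn -[_ == _]/(j == Ordinal lt_in) (negPf neq_ji) scale0r.
Qed.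

Hypothesis cuw : GRing.comm u w.

Lemma hformM n m p q : (size p <= n.+1)%N -> (size q <= m.+1)%N ->
  hform (n + m) (p * q) = hform n p * hform m q.
Proof.
move=> le_p le_q.
have sumE k (r : {poly K}) : (size r <= k.+1)%N ->
    r = \sum_(i < k.+1) r`_i *: 'X^i.
  by move=> le_r; rewrite -poly_def; apply/polyP => i; rewrite coef_poly;
    case: ltnP => // /(leq_trans le_r) le_ri; rewrite nth_default.
rewrite {1}(sumE _ _ le_p) {1}(sumE _ _ le_q) mulr_suml linear_sum.
rewrite [X in _ = X * _]/hform mulr_suml; apply: eq_bigr => i _.
rewrite mulr_sumr linear_sum mulr_sumr; apply: eq_bigr => j _ /=.
rewrite -scalerAl -scalerAr -exprD !linearZ /= hformXn; last first.
  by rewrite leq_add // -ltnS ltn_ord.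
have le_in : (i <= n)%N by rewrite -ltnS ltn_ord.
have le_jm : (j <= m)%N by rewrite -ltnS ltn_ord.
have -> : (n + m - (i + j) = (n - i) + (m - j))%N by lia.
rewrite -!scalerAl -!scalerAr !exprD -!mulrA; do 2!congr (_ *: _); congr (_ * _).
by rewrite !mulrA; congr (_ * _); apply: commrX; apply/commr_sym/commrX.
Qed.

Lemma hform1 : hform 1 1 = w.
Proof. by rewrite -[1 in LHS](expr0 'X) hformXn // mul1r expr1. Qed.

Lemma hform0E p : hform 0 p = p`_0 *: 1.
Proof. by rewrite /hform big_ord1 mul1r. Qed.

Lemma hformS n p : (size p <= n.+1)%N -> hform n.+1 p = w * hform n p.
Proof.
by move=> le_p; rewrite -[p in LHS]mul1r -add1n hformM ?size_poly1 // hform1.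
Qed.

End Def.

(* The dehomogenization of p(u, v) in the coordinates u, v - c u. *)
Definition shear (c : K) n (p : {poly K}) : {poly K} :=
  hform 'X (1 + c *: 'X) n p.

Lemma size_exp_leS (r : {poly K}) k : (size r <= 2)%N -> (size (r ^+ k) <= k.+1)%N.
Proof.
move=> le_r; rewrite (leq_trans (size_poly_exp_leq _ _)) // ltnS.
rewrite -[leqRHS]mul1n leq_mul2r; move: le_r.
by case: size => [|[|[]]] //=; rewrite orbT.
Qed.

Lemma size_hform (a b : {poly K}) n p :
  (size a <= 2)%N -> (size b <= 2)%N -> (size (hform a b n p) <= n.+1)%N.
Proof.
move=> le_a le_b; rewrite (leq_trans (size_sum _ _ _)) //.
apply/bigmax_leqP => i _; rewrite (leq_trans (size_scale_leq _ _)) //.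
rewrite (leq_trans (size_polyMleq _ _)) //.
move: (size_exp_leS i le_a) (size_exp_leS (n - i)%N le_b) (ltn_ord i).
by move: (size _) (size _) => x y; lia.
Qed.

Lemma size_1DcX (c : K) : (size (1 + c *: 'X)%R <= 2)%N.
Proof.
rewrite (leq_trans (size_polyD _ _)) // geq_max size_poly1 /=.
by rewrite (leq_trans (size_scale_leq _ _)) ?size_polyX.
Qed.

Lemma size_shear c n p : (size (shear c n p) <= n.+1)%N.
Proof. by rewrite size_hform ?size_1DcX ?size_polyX. Qed.

Lemma hform_shear (B : algType K) (u w : B) c n p : GRing.comm u w ->
  hform u (w + c *: u) n p = hform u w n (shear c n p).
Proof.
move=> cuw; rewrite [LHS]/hform /shear [X in _ = hform _ _ _ X]/hform linear_sum /=.
apply: eq_bigr => i _; rewrite linearZ /=; congr (_ *: _).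
have le_in : (i <= n)%N by rewrite -ltnS ltn_ord.
have hE k : hform u w k ((1 + c *: 'X) ^+ k) = (w + c *: u) ^+ k.
  elim: k => [|k IHk]; first by rewrite !expr0 hform0E coef1 scale1r.
  rewrite !exprS -add1n hformM ?size_1DcX -?IHk //.
    rewrite linearD linearZ /= hform1 -{1}['X]expr1 hformXn //.
    by rewrite mulr1.
  by rewrite size_exp_leS ?size_1DcX.
have /(_ (n - i)%N) :=
  hformM cuw (n := i) (p := 'X^i) _ (size_exp_leS _ (size_1DcX c)).
rewrite subnKC // => ->; last by rewrite size_polyXn.
by rewrite hE hformXn // subnn mulr1.
Qed.

Lemma hformX1 n (p : {poly K}) : (size p <= n.+1)%N -> hform 'X 1 n p = p.
Proof.
move=> le_p; rewrite /hform; under eq_bigr do rewrite expr1n mulr1.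
rewrite -poly_def; apply/polyP => i; rewrite coef_poly.
by case: ltnP => // /(leq_trans le_p) le_ri; rewrite nth_default.
Qed.

Lemma shearNK c n (p : {poly K}) : (size p <= n.+1)%N ->
  shear c n (shear (- c) n p) = p.
Proof.
move=> le_p; rewrite {1}/shear -hform_shear ?scaleNr ?addrK; last exact: mulrC.
exact: hformX1.
Qed.

Lemma shearK c n (p : {poly K}) : (size p <= n.+1)%N ->
  shear (- c) n (shear c n p) = p.
Proof. by move=> le_p; have := shearNK (- c) le_p; rewrite opprK. Qed.

Lemma shear_eq0 c n (p : {poly K}) : (size p <= n.+1)%N ->
  (shear c n p == 0) = (p == 0).
Proof.
move=> le_p; apply/eqP/eqP => [p0|->]; last by rewrite /shear linear0.
by rewrite -(shearK c le_p) p0 /shear linear0.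
Qed.

(* The polynomial r vanishes at the c for which the line at infinity divides the *)
(* sheared form.                                                                *)
Lemma shear_lead n (p : {poly K}) : (size p <= n.+1)%N -> p != 0 ->
  exists2 r : {poly K}, r != 0 &
    forall c, ~~ root r c -> size (shear c n p) = n.+1.
Proof.
move=> le_p nz_p; exists (\poly_(i < n.+1) p`_(n - i)).
  apply: contraNneq nz_p => r0; apply/eqP/polyP => i; rewrite coef0.
  have [le_in|lt_ni] := leqP i n; last by rewrite nth_default ?(leq_trans le_p).
  have /polyP/(_ (n - i)%N) := r0; rewrite coef0 coef_poly subKn //.
  by rewrite ltnS leq_subr.
move=> c; rewrite rootE horner_poly => nz_r; apply/eqP.
rewrite eqn_leq size_shear /=; apply: contraR nz_r; rewrite -leqNgt => le_n.
have /eqP := nth_default 0 le_n; apply: etrans.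
congr (_ == _); rewrite /shear /hform coef_sum.
rewrite (reindex_inj rev_ord_inj); apply: eq_bigr => i _.
rewrite coefZ /= subSS; have le_in : (i <= n)%N by rewrite -ltnS ltn_ord.
rewrite subKn // coefXnM ltnNge le_in /=; congr (_ * _).
elim: (n - i)%N => [|k IHk]; first by rewrite !expr0 coef1.
rewrite [in RHS]exprS mulrDl mul1r coefD -scalerAl coefZ coefXM /= -IHk.
rewrite nth_default ?add0r -?exprS //.
by rewrite size_exp_leS ?size_1DcX.
Qed.

End Homogenization.

(** * Extensions of binary forms by a square-zero ideal *)

(** The functionals b |-> phi (a b) embed V into the dual of W. *)
Lemma leq_dim_pairing (K : fieldType) (A : falgType K) (phi : {scalar A})
    (V W : {vspace A}) :
    {in V, forall a, {in W, forall b, phi (a * b) = 0} -> a = 0} ->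
  (\dim V <= \dim W)%N.
Proof.
move=> nondeg; pose f (a : A) : 'rV[K]_(\dim W) := \row_j phi (a * (vbasis W)`_j).
have f_lin : linear f.
  by move=> c a b; apply/rowP => j; rewrite !mxE mulrDl -scalerAl linearP.
pose fL := HB.pack_for {linear A -> 'rV[K]_(\dim W)} f
  (GRing.isLinear.Build K A 'rV[K]_(\dim W) _ f f_lin).
rewrite -(@limg_dim_eq _ _ _ (linfun fL)); last first.
  apply/eqP; rewrite -subv0; apply/subvP => a; rewrite memv_cap memv_ker memv0.
  rewrite lfunE /= => /andP[Va /eqP/rowP fa0]; apply/eqP/nondeg => // b Wb.
  rewrite (coord_vbasis Wb) mulr_sumr linear_sum big1 // => j _.
  by rewrite -scalerAr linearZ /=; have := fa0 j; rewrite !mxE => ->; rewrite mulr0.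
by rewrite (leq_trans (dimvS (subvf _))) // dimvf /dim /= mul1n.
Qed.

Lemma ltn_size_gcdp (K : fieldType) (p q : {poly K}) :
  p != 0 -> ~~ (p %| q) -> (size (gcdp p q) < size p)%N.
Proof.
move=> nz_p; apply: contraR; rewrite -leqNgt => le_p.
rewrite -(eqp_dvdl _ (_ : gcdp p q %= p)) ?dvdp_gcdr // -dvdp_size_eqp
  ?dvdp_gcdl // eqn_leq le_p dvdp_leq ?dvdp_gcdl //.
Qed.

(* What is used of A_F: gr i = (x) S_(i-1) + S_i for S = K[u,v]. At i = 0 the   *)
(* bound on b k is 0, so that the junk index i.-1 does no harm.                *)
Record square_zero_ext (K : fieldType) (A : falgType K) (gr : nat -> {vspace A})
    (d : nat) (x : 'I_3 -> A) (u v : A) (phi : {scalar A}) : Prop :=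
  SquareZeroExt {
    ext_mulC : @commutative A A *%R;
    ext_xx0 : forall k l, x k * x l = 0;
    ext_free :
      forall c : 'I_3 -> K, \sum_k c k *: x k = 0 -> forall k, c k = 0;
    ext_grP : forall i a, a \in gr i <->
      exists (b : 'I_3 -> {poly K}) (q : {poly K}),
        [/\ forall k, (size (b k) <= i)%N, (size q <= i.+1)%N
          & a = \sum_k x k * hform u v i.-1 (b k) + hform u v i q];
    ext_nondeg : forall i, (i <= d)%N ->
      {in gr i, forall a, {in gr (d - i)%N, forall b, phi (a * b) = 0} -> a = 0};
    ext_gr_gt : forall i, (d < i)%N -> {in gr i, forall a, a = 0} }.

Section SquareZeroExtension.

Variables (K : fieldType) (A : falgType K) (gr : nat -> {vspace A}) (d : nat).
Variables (x : 'I_3 -> A) (u v : A) (phi : {scalar A}).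
Hypothesis ext : square_zero_ext gr d x u v phi.

Let mulC := ext_mulC ext.
Let xx0 := ext_xx0 ext.
Let grP := ext_grP ext.
Let gr_nondeg := ext_nondeg ext.
Let gr_gt := ext_gr_gt ext.

Let comm (a b : A) : GRing.comm a b. Proof. exact: mulC. Qed.

Let mulCA : @left_commutative A A *%R.
Proof. by move=> a b c; rewrite !mulrA (mulC a). Qed.

Let mulAC : @right_commutative A A *%R.
Proof. by move=> a b c; rewrite -!mulrA (mulC b). Qed.

Lemma grM i j a b : a \in gr i -> b \in gr j -> a * b \in gr (i + j)%N.
Proof.
move=> /grP[f [p [le_f le_p ->]]] /grP[g [q [le_g le_q ->]]].
have szM (r s : {poly K}) (k l : nat) : (size r <= k -> size s <= l.+1 ->
    size (r * s)%R <= k + l)%N.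
  by move=> le_r le_s; have := size_polyMleq r s; lia.
apply/grP; exists (fun k => f k * q + p * g k), (p * q); split.
- move=> k; rewrite (leq_trans (size_polyD _ _)) // geq_max szM //=.
  by rewrite mulrC addnC szM.
- by rewrite -addSn szM.
rewrite mulrDl !mulrDr hformM // addrA; congr (_ + _).
(* The product of the two (x)-parts vanishes because x_k x_l = 0. *)
rewrite [X in X + _ + _](_ : _ = 0) ?add0r; last first.
  rewrite mulr_suml big1 // => k _; rewrite mulr_sumr big1 // => l _.
  by rewrite mulC -!mulrA [_ * (x k * _)]mulrA [_ * x k]mulC !mulrA xx0 !mul0r.
rewrite mulr_suml mulr_sumr -big_split; apply: eq_bigr => k _ /=.
rewrite linearD mulrDr -mulrA [hform _ _ _ p * _]mulC -mulrA; congr (_ * _ + _ * _).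
  case: i le_f {le_p} => [|i] le_f /=.
    by have /size_poly_leq0P-> := le_f k; rewrite mul0r !linear0 mul0r.
  by rewrite -hformM.
case: j le_g {le_q} => [|j] le_g /=.
  by have /size_poly_leq0P-> := le_g k; rewrite mulr0 !linear0 mul0r.
by rewrite mulC addnS -hformM.
Qed.

Lemma hform_gr n (p : {poly K}) : (size p <= n.+1)%N -> hform u v n p \in gr n.
Proof.
move=> le_p; apply/grP; exists (fun=> 0), p; split=> // [k|].
  by rewrite size_poly0.
by rewrite big1 ?add0r // => k _; rewrite linear0 mulr0.
Qed.

Lemma x_gr k : x k \in gr 1.
Proof.
apply/grP; exists (fun l => (l == k)%:R), 0; split=> [l||].
- by case: eqP; rewrite ?size_poly1 ?size_poly0.
- by rewrite size_poly0.
rewrite linear0 addr0 (bigD1 k) //= eqxx hform0E coef1 scale1r mulr1.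
by rewrite big1 ?addr0 // => l /negPf->; rewrite linear0 mulr0.
Qed.

Lemma dim_gr_sym i : (i <= d)%N -> \dim (gr (d - i)%N) = \dim (gr i).
Proof.
move=> le_id; apply/eqP; rewrite eqn_leq; apply/andP; split.
  apply: (@leq_dim_pairing _ _ phi) => a gr_a; rewrite -{1}(subKn le_id).
  by apply: gr_nondeg gr_a; rewrite leq_subr.
by apply: (@leq_dim_pairing _ _ phi); apply: gr_nondeg.
Qed.

(** Since the x_k kill a, the (x)-part of the complementary degree pairs to zero with a; only binary
    forms remain to be tested. *)
Lemma gr_ann0 i a : (i <= d)%N -> a \in gr i -> (forall k, x k * a = 0) ->
    (forall p : {poly K}, (size p <= (d - i).+1)%N ->
       phi (a * hform u v (d - i) p) = 0) ->
  a = 0.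
Proof.
move=> le_id gr_a xa0 fa0; apply: (gr_nondeg le_id gr_a) => b.
case/grP=> f [q [_ le_q ->]]; rewrite mulrDr mulr_sumr linearD fa0 // addr0.
by rewrite big1 ?linear0 // => k _; rewrite mulrA [a * _]mulC xa0 mul0r.
Qed.

(** * Binary forms annihilating a family of elements *)

Section Annihilated.

Variables (m : nat) (z : 'I_m -> A).

Definition ann_map n (r : 'rV[K]_n.+1) : {ffun 'I_m -> A} :=
  [ffun t => z t * hform u v n (rVpoly r)].

Fact ann_map_is_linear n : linear (@ann_map n).
Proof.
move=> c r s; apply/ffunP => t; rewrite !ffunE !linearP /= mulrDr.
by rewrite -scalerAr.
Qed.

HB.instance Definition _ n :=
  GRing.isLinear.Build K 'rV[K]_n.+1 {ffun 'I_m -> A} _ (@ann_map n)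
    (@ann_map_is_linear n).

(** For z = x this is I_n <> 0, for z = f^2 it is (0 : f^2)_n <> 0. The form is nonzero as a
    polynomial; its value in A may vanish. Being boolean, the property has a least degree. *)
Definition has_ann_form n : bool := lker (linfun (@ann_map n)) != 0%VS.

Lemma has_ann_formP n :
  reflect (exists p : {poly K}, [/\ p != 0, (size p <= n.+1)%N
             & forall t, z t * hform u v n p = 0]) (has_ann_form n).
Proof.
apply: (iffP idP) => [nz|[p [nz_p le_p zp0]]].
  have := memv_pick (lker (linfun (@ann_map n))).
  rewrite memv_ker lfunE => /eqP/ffunP r0.
  exists (rVpoly (vpick (lker (linfun (@ann_map n))))).
  split=> [||t]; last by have := r0 t; rewrite !ffunE.
    apply: contraNneq nz => r00; rewrite -vpick0; apply/eqP.
    by rewrite -[LHS]rVpolyK r00 linear0.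
  exact: size_poly.
apply: contraNneq nz_p => ker0; have : poly_rV p \in lker (linfun (@ann_map n)).
  rewrite memv_ker lfunE; apply/eqP/ffunP => t.
  by rewrite !ffunE poly_rV_K.
by rewrite ker0 memv0 => /eqP p0; rewrite -(poly_rV_K le_p) p0 linear0.
Qed.

Lemma has_ann_formS n : has_ann_form n -> has_ann_form n.+1.
Proof.
case/has_ann_formP=> p [nz_p le_p zp0]; apply/has_ann_formP; exists p.
split=> //; first by rewrite ltnW.
by move=> t; rewrite hformS // mulCA zp0 mulr0.
Qed.

Lemma has_ann_form_leq n n' : (n <= n')%N -> has_ann_form n -> has_ann_form n'.
Proof.
by move/subnK<-; elim: (n' - n)%N => // k IHk /IHk; apply: has_ann_formS.
Qed.

End Annihilated.

(** * The Hilbert function, and failure of the WLP *)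

Definition formsUV n : {vspace A} := limg (linfun (hform u v n \o @rVpoly K n.+1)).

Lemma mem_formsUV n a : a \in formsUV n <->
  exists2 p : {poly K}, (size p <= n.+1)%N & a = hform u v n p.
Proof.
split=> [/memv_imgP[r _ ->]|[p le_p ->]].
  by rewrite lfunE; exists (rVpoly r) => //; apply: size_poly.
have -> : hform u v n p = linfun (hform u v n \o @rVpoly K n.+1) (poly_rV p).
  by rewrite lfunE /= poly_rV_K.
by rewrite memv_img ?memvf.
Qed.

Lemma leq_dim_limg (V W : vectType K) (f : 'Hom(V, W)) U :
  (\dim (f @: U) <= \dim U)%N.
Proof. by rewrite -(limg_ker_dim f U) leq_addl. Qed.

Lemma dim_rV n : \dim {:'rV[K]_n} = n.
Proof. by rewrite dimvf /dim /= mul1n. Qed.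

Lemma dim_formsUV n : (\dim (formsUV n) <= n.+1)%N.
Proof. by rewrite (leq_trans (leq_dim_limg _ _)) ?dim_rV. Qed.

(** Triples of polynomials as matrices, so that (x) S_(n-1) is the image of a linear map; for n = 0
    this image is 0. *)
Definition xform n (r : 'M[K]_(3, n)) : A :=
  \sum_k x k * hform u v n.-1 (rVpoly (row k r)).

Fact xform_is_linear n : linear (@xform n).
Proof.
move=> c r s; rewrite /xform scaler_sumr -big_split; apply: eq_bigr => k _ /=.
by rewrite !linearP /= mulrDr -scalerAr.
Qed.

HB.instance Definition _ n :=
  GRing.isLinear.Build K 'M[K]_(3, n) A _ (@xform n) (@xform_is_linear n).

Definition xforms n : {vspace A} := limg (linfun (@xform n)).

Lemma mem_xforms n a : a \in xforms n <->
  exists2 b : 'I_3 -> {poly K}, forall k, (size (b k) <= n)%N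
    & a = \sum_k x k * hform u v n.-1 (b k).
Proof.
split=> [/memv_imgP[r _ ->]|[b le_b ->]].
  by rewrite lfunE; exists (fun k => rVpoly (row k r)) => // k; apply: size_poly.
have -> : \sum_k x k * hform u v n.-1 (b k)
        = linfun (@xform n) (\matrix_(k < 3) (poly_rV (b k) : 'rV_n)).
  by rewrite lfunE; apply: eq_bigr => k _; rewrite rowK poly_rV_K.
by rewrite memv_img ?memvf.
Qed.

Lemma gr_split n : gr n = (xforms n + formsUV n)%VS.
Proof.
apply/vspaceP => a; apply/idP/memv_addP.
  case/grP=> b [q [le_b le_q ->]]; exists (\sum_k x k * hform u v n.-1 (b k)).
    by apply/mem_xforms; exists b.
  by exists (hform u v n q) => //; apply/mem_formsUV; exists q.
case=> _ /mem_xforms[b le_b ->] [_ /mem_formsUV[q le_q ->] ->].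
by apply/grP; exists b, q.
Qed.

Lemma xforms_sub n a : a \in xforms n -> a \in gr n.
Proof. by rewrite gr_split; apply: subvP; apply: addvSl. Qed.

Lemma x_xforms k n a : a \in xforms n -> x k * a = 0.
Proof.
case/mem_xforms=> b _ ->; rewrite mulr_sumr big1 // => l _.
by rewrite mulrA xx0 mul0r.
Qed.

Lemma xforms_nondeg n : (n <= d)%N ->
  {in xforms n, forall a,
    {in formsUV (d - n)%N, forall b, phi (a * b) = 0} -> a = 0}.
Proof.
move=> le_nd a Na fa0; apply: (gr_ann0 le_nd (xforms_sub Na)) => [k|p le_p].
  exact: x_xforms Na.
by apply: fa0; apply/mem_formsUV; exists p.
Qed.

Lemma dim_xforms n : (n <= d)%N -> (\dim (xforms n) <= (d - n).+1)%N.
Proof.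
move=> le_nd; apply: leq_trans (dim_formsUV _).
by apply: (@leq_dim_pairing _ _ phi); apply: xforms_nondeg.
Qed.

(** The annihilating form p pairs to zero with (x), so the pairing with forms of degree n is
    determined on a complement of the line of p, of dimension n. *)
Lemma dim_xforms_ann n : (n <= d)%N -> has_ann_form x n ->
  (\dim (xforms (d - n)) <= n)%N.
Proof.
move=> le_nd /has_ann_formP[p [nz_p le_p xp0]].
pose f := linfun (hform u v n \o @rVpoly K n.+1).
have dimW : \dim (<[poly_rV p : 'rV[K]_n.+1]>^C)%VS = n.
  rewrite dimv_compl dim_rV dim_vline; case: eqP => [p0|_]; last by rewrite subn1.
  by case/eqP: nz_p; rewrite -(poly_rV_K le_p) p0 linear0.
rewrite -[leqRHS]dimW; apply: leq_trans (leq_dim_limg f _).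
apply: (@leq_dim_pairing _ _ phi) => a Na fa0.
apply: (xforms_nondeg _ Na); first exact: leq_subr.
rewrite subKn // => _ /memv_imgP[r _ ->].
have := memvf r; rewrite -(addv_complf <[poly_rV p : 'rV[K]_n.+1]>%VS).
case/memv_addP=> _ /vlineP[c ->] [s Ws ->]; rewrite linearP mulrDr linearD /=.
rewrite [X in _ + X]fa0 ?memv_img // addr0 -scalerAr linearZ lfunE /=.
rewrite poly_rV_K //; case/mem_xforms: Na => b _ ->.
rewrite mulr_suml big1 ?linear0 ?mulr0 //.
by move=> k _; rewrite mulAC [x k * _]xp0 mul0r.
Qed.

Lemma xann_eq0 n (p : {poly K}) : ~~ has_ann_form x n -> (size p <= n.+1)%N ->
  (forall k, x k * hform u v n p = 0) -> p = 0.
Proof.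
move=> no_ann le_p xp0; apply: contraNeq no_ann => nz_p.
by apply/has_ann_formP; exists p.
Qed.

Lemma dim_formsUV_no_ann n : ~~ has_ann_form x n -> \dim (formsUV n) = n.+1.
Proof.
move=> no_ann; rewrite -[RHS]dim_rV; apply: limg_dim_eq.
apply/eqP; rewrite -subv0; apply/subvP => r; rewrite memv_cap memv_ker memv0.
rewrite lfunE => /andP[_ /eqP r0].
rewrite -[r]rVpolyK (@xann_eq0 n (rVpoly r)) ?linear0 //.
  exact: size_poly.
by move=> k; rewrite [hform _ _ _ _]r0 mulr0.
Qed.

(** If p pairs to zero with (x) S_(d-n-1), then each x_k p pairs to zero with everything, so x_k p =
    0 and p = 0. Hence S_n embeds in the dual of (x) S_(d-n-1). *)
Lemma dim_xforms_no_ann n : (n <= d)%N -> ~~ has_ann_form x n ->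
  \dim (xforms (d - n)) = n.+1.
Proof.
move=> le_nd no_ann; apply/eqP; rewrite eqn_leq.
have := @dim_xforms (d - n)%N; rewrite leq_subr subKn // => -> //=.
rewrite -(dim_formsUV_no_ann no_ann); apply: (@leq_dim_pairing _ _ phi) => a.
case/mem_formsUV=> p le_p -> fp0; rewrite (@xann_eq0 n p) ?linear0 // => k.
have [lt_nd|le_dn] := ltnP n d; last first.
  by apply: (@gr_gt n.+1); rewrite // -add1n grM ?x_gr ?hform_gr.
apply: (@gr_ann0 n.+1) => // [|l|q le_q].
- by rewrite -add1n grM ?x_gr ?hform_gr.
- by rewrite mulrA xx0 mul0r.
rewrite [x k * _]mulC -mulrA fp0 //; apply/mem_xforms.
exists (fun l => if l == k then q else 0) => [l|].
  by case: ifP; rewrite ?size_poly0 // (leq_trans le_q) // subnSK.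
rewrite (bigD1 k) //= eqxx -subnS big1 ?addr0 // => l /negPf->.
by rewrite linear0 mulr0.
Qed.

(** The two summands of gr i have dimension at most d - i + 1 and i + 1. An annihilating form of
    degree d - i lowers the first bound; one of degree i does so in degree d - i, and h is
    symmetric. Without them both bounds are attained and the sum is direct, since (x) is killed by
    the x_k. *)
Lemma dim_gr_max i : (i <= d)%N ->
  (\dim (gr i) == d.+2) = ~~ has_ann_form x i && ~~ has_ann_form x (d - i).
Proof.
move=> le_id; apply/idP/andP => [/eqP dim_i|[no_i no_di]].
  have dim_le j : (\dim (gr j) <= \dim (xforms j) + \dim (formsUV j))%N.
    by rewrite gr_split; apply: dimv_add_leqif.
  split; apply/negP => ann.
    have := dim_xforms_ann le_id ann; have := dim_le (d - i)%N.
    by rewrite dim_gr_sym // dim_i; have := dim_formsUV (d - i)%N; lia.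
  have := dim_xforms_ann (leq_subr _ _) ann; rewrite subKn //.
  by have := dim_le i; rewrite dim_i; have := dim_formsUV i; lia.
rewrite gr_split dimv_disjoint_sum.
  rewrite dim_formsUV_no_ann // -{1}(subKn le_id) dim_xforms_no_ann ?leq_subr //.
  by apply/eqP; lia.
apply/eqP; rewrite -subv0; apply/subvP => a; rewrite memv_cap memv0.
case/andP=> Na /mem_formsUV[p le_p def_a]; rewrite def_a (@xann_eq0 i p) ?linear0 //.
by move=> k; rewrite -def_a (x_xforms k Na).
Qed.

Lemma not_WLP : ~~ has_ann_form x d./2.+1 -> (0 < d)%N -> ~ WLP gr.
Proof.
move=> no_ann d_gt0 [l gr_l].
have [i def_i] : {i | i = (d - d./2.+1)%N} by exists (d - d./2.+1)%N.
have [lt_id [le_i [le_di le_dSi]]] : (i < d)%N /\ (i.+1 <= d./2.+1)%N /\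
    (d - i <= d./2.+1)%N /\ (d - i.+1 <= d./2.+1)%N by lia.
move/(_ i).
have no_annW j : (j <= d./2.+1)%N -> ~~ has_ann_form x j.
  by move=> le_j; apply: contra no_ann; apply: has_ann_form_leq.
have dim_i : \dim (gr i) = d.+2.
  by apply/eqP; rewrite dim_gr_max 1?ltnW // no_annW 1?ltnW // no_annW.
have dim_Si : \dim (gr i.+1) = d.+2.
  by apply/eqP; rewrite dim_gr_max // no_annW // no_annW.
pose f := amull l; have fE a : f a = l * a by rewrite lfunE.
have not_inj : (gr i :&: lker f != 0)%VS.
  apply/negP => /eqP ker0.
  (* Only the binary part of l acts on (x), so l maps a space of dimension d - i + 1 to one of
     dimension at most d - i. *)
  have f_xforms : (f @: xforms i <= xforms i.+1)%VS.
    apply/subvP => _ /memv_imgP[a Na ->]; rewrite fE.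
    have /grP[c [r [le_c le_r ->]]] := gr_l.
    rewrite mulrDl mulr_suml big1 ?add0r => [|k _]; last first.
      by rewrite mulAC (x_xforms k Na) mul0r.
    case/mem_xforms: Na => b le_b ->; apply/mem_xforms; exists (fun k => r * b k).
      by move=> k; have := size_polyMleq r (b k); have := le_b k; lia.
    rewrite mulr_sumr; apply: eq_bigr => k _; rewrite mulCA; congr (_ * _).
    case: (i) le_b => [|j] le_b /=; last by rewrite -hformM.
    by have /size_poly_leq0P-> := le_b k; rewrite mulr0 !linear0 mulr0.
  have := dimvS f_xforms; rewrite limg_dim_eq; last first.
    by apply/eqP; rewrite -subv0 -ker0 capvS // gr_split addvSl.
  rewrite -{1}(subKn (ltnW lt_id)) dim_xforms_no_ann ?leq_subr ?no_annW //.
  by move/leq_trans/(_ (dim_xforms lt_id)); rewrite subnSK // ltnn.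
case=> [inj|surj].
  case/eqP: not_inj; apply/eqP; rewrite -subv0; apply/subvP => a.
  rewrite memv_cap memv_ker memv0 fE => /andP[gr_a /eqP la0].
  by apply/eqP/inj; rewrite ?mem0v // la0 mulr0.
have /dimvS : (gr i.+1 <= f @: gr i)%VS.
  by apply/subvP => b /surj[a gr_a <-]; rewrite -fE memv_img.
rewrite dim_Si -dim_i -(limg_ker_dim f (gr i)) leqNgt -[ltnLHS]add0n ltn_add2r.
by rewrite lt0n dimv_eq0 not_inj.
Qed.

(** * Annihilating forms as multiples of one of least degree *)

Lemma ideal_hform (z : A) s e (f p : {poly K}) :
    (size f <= s.+1)%N -> z * hform u v s f = 0 ->
  (size p <= e.+1 - s)%N -> z * hform u v e (f * p) = 0.
Proof.
(* For s > e the truncated bound forces p = 0. *)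
move=> le_f zf0 le_p; have [->|nz_p] := eqVneq p 0.
  by rewrite mulr0 linear0 mulr0.
have le_se : (s <= e)%N by move: nz_p; rewrite -size_poly_gt0; lia.
rewrite -[in hform _ _ e](subnKC le_se) hformM //; last by rewrite -subSn.
by rewrite mulrA zf0 mul0r.
Qed.

(** S / (0 : z) has no socle below degree e, as in a level algebra: up to degree e, the ideal (0 :
    z) is determined by its part of degree e. *)
Definition level (z : A) e := forall n (h : {poly K}), (n <= e)%N ->
  (size h <= n.+1)%N ->
  (forall r : {poly K}, (size r <= (e - n).+1)%N -> z * hform u v e (h * r) = 0) ->
  z * hform u v n h = 0.

Lemma gr_level z i : (i <= d)%N -> z \in gr i -> (forall k, x k * z = 0) ->
  level z (d - i).
Proof.
move=> le_id gr_z xz0 n h le_n le_h zh0.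
have le_in : (i + n <= d)%N by lia.
apply: (@gr_ann0 (i + n)) => // [||p le_p]; first by rewrite grM ?hform_gr.
  by move=> k; rewrite mulrA xz0 mul0r.
rewrite -mulrA -hformM //; have -> : (n + (d - (i + n)) = d - i)%N by lia.
by rewrite zh0 ?linear0 //; move: le_p; rewrite subnDA.
Qed.

(* Modulo the coprime cofactors of f and g every form of large enough degree is *)
(* zero, so that the gcd annihilates z in large degree, whence in its own.      *)
Lemma gcd_ann (z : A) e s j (f g : {poly K}) : level z e ->
    size f = s.+1 -> (size g <= j.+1)%N -> ~~ (f %| g) ->
    (s + j <= e.+1 + (size (gcdp f g)).-1)%N ->
    z * hform u v s f = 0 -> z * hform u v j g = 0 ->
  z * hform u v (size (gcdp f g)).-1 (gcdp f g) = 0.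
Proof.
move=> lev sz_f sz_g ndv le_sj zf0 zg0.
have nz_f : f != 0 by rewrite -size_poly_gt0 sz_f.
have nz_g : g != 0 by apply: contraNneq ndv => ->; rewrite dvdp0.
set h := gcdp f g in le_sj *.
have nz_h : h != 0 by rewrite gcdp_eq0 negb_and nz_f.
pose f1 : {poly K} := f %/ h; pose g1 : {poly K} := g %/ h.
have def_f : f = h * f1 by rewrite mulrC divpK ?dvdp_gcdl.
have def_g : g = h * g1 by rewrite mulrC divpK ?dvdp_gcdr.
have nz_f1 : f1 != 0 by apply: contraNneq nz_f => f10; rewrite def_f f10 mulr0.
have nz_g1 : g1 != 0 by apply: contraNneq nz_g => g10; rewrite def_g g10 mulr0.
have sz_hf1 : s.+1 = (size h + size f1).-1 by rewrite -size_mul // -def_f.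
have sz_hg1 : size g = (size h + size g1).-1 by rewrite -size_mul // -def_g.
have h_gt0 : (0 < size h)%N by rewrite size_poly_gt0.
have g1_gt0 : (0 < size g1)%N by rewrite size_poly_gt0.
have := ltn_size_gcdp nz_f ndv; rewrite -/h sz_f => lt_hs.
have le_he : ((size h).-1 <= e)%N.
  lia.
apply: lev => // [|r sz_r]; first by rewrite prednK.
have /Bezout_eq1_coprimepP[[a b] /= Eab] : coprimep f1 g1.
  by rewrite coprimep_div_gcd ?nz_f.
(* Reduction modulo f1 bounds the degree of B; that of C is read off f1 C = r - g1 B. By [le_sj]
   both cofactors fit into degree e. *)
pose B : {poly K} := (r * b) %% f1.
pose C : {poly K} := r * a + g1 * ((r * b) %/ f1).
have def_r : r = f1 * C + g1 * B.
  rewrite -[LHS]mulr1 -Eab; have := divp_eq (r * b) f1; rewrite -/B => Erb.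
  rewrite mulrDr [r * (b * g1)]mulrA Erb /C; ring.
have sz_B : (size B < size f1)%N by rewrite ltn_modp.
have sz_g1B := size_polyMleq g1 B.
have sz_C : (size C <= e.+1 - s)%N.
  have [->|nz_C] := eqVneq C 0; first by rewrite size_poly0.
  have C_gt0 : (0 < size C)%N by rewrite size_poly_gt0.
  have : ((size f1 + size C).-1 <= maxn (size r) (size (g1 * B)%R))%N.
    rewrite -size_mul //; have <- : r - g1 * B = f1 * C by rewrite {1}def_r addrK.
    by rewrite -(size_polyN (g1 * B)) size_polyD.
  lia.
have sz_B1 : (size B <= e.+1 - j)%N by lia.
rewrite [in h * r]def_r mulrDr !mulrA -def_f -def_g linearD mulrDr /=.
by rewrite (ideal_hform _ zf0) ?sz_f // (ideal_hform _ zg0) ?add0r.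
Qed.

(** By [gcd_ann] the gcd annihilates every z t; if f did not divide g, its degree would be less than
    the minimum s. *)
Lemma ann_dvdp m (z : 'I_m -> A) e s j (f g : {poly K}) :
    (forall t, level (z t) e) -> (forall n, (n < s)%N -> ~~ has_ann_form z n) ->
    size f = s.+1 -> (size g <= j.+1)%N ->
    (s + j <= e.+1 + (size (gcdp f g)).-1)%N ->
    (forall t, z t * hform u v s f = 0) -> (forall t, z t * hform u v j g = 0) ->
  f %| g.
Proof.
move=> lev min_s sz_f sz_g le_sj zf0 zg0; apply/idPn => ndv.
have nz_f : f != 0 by rewrite -size_poly_gt0 sz_f.
have nz_h : gcdp f g != 0 by rewrite gcdp_eq0 negb_and nz_f.
have lt_hs : ((size (gcdp f g)).-1 < s)%N.
  by rewrite -ltnS -sz_f prednK ?size_poly_gt0 ?ltn_size_gcdp.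
case/negP: (min_s _ lt_hs); apply/has_ann_formP; exists (gcdp f g).
split=> // [|t]; first by rewrite prednK ?size_poly_gt0.
exact: (@gcd_ann _ e s j).
Qed.

Lemma v_hform n (p : {poly K}) : (size p <= n)%N -> exists b, hform u v n p = v * b.
Proof.
case: n => [/size_poly_leq0P->|n le_p]; first by exists 0; rewrite linear0 mulr0.
by exists (hform u v n p); rewrite hformS.
Qed.

Lemma x_gr_level k : (0 < d)%N -> level (x k) d.-1.
Proof. by move=> d_gt0; rewrite -subn1; apply: gr_level (x_gr k) _. Qed.

(* In odd degree 2k + 1 two coprime forms of degree k + 1 would leave room for *)
(* a single functional on forms of degree 2k, against the independence of x.   *)
Lemma middle_dvdp k (f q : {poly K}) : d = k.*2.+1 ->
    (forall n, (n < k.+1)%N -> ~~ has_ann_form x n) ->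
    size f = k.+2 -> (size q <= k.+1)%N ->
    (forall l, x l * hform u v k.+1 f = 0) ->
    (forall l, x l * hform u v k.+1 q = 0) ->
  f %| q.
Proof.
move=> def_d min_k sz_f sz_q xf0 xq0.
(* A common factor of positive degree makes up for the one missing in the degree bound. *)
have [h0|lt0h] := posnP (size (gcdp f q)).-1; last first.
  apply: (@ann_dvdp _ x d.-1 k.+1 k.+1) => // [l||]; last by rewrite def_d; lia.
    by apply: x_gr_level; rewrite def_d.
  exact: leqW.
apply/idPn => ndv.
pose y l := phi (x l * hform u v k.*2 (q * 'X^k)).
pose i1 : 'I_3 := inord 1.
(* A nonzero vector orthogonal to y, so that z pairs to zero with q u^k. *)
pose c l : K := if y ord0 == 0 then (l == ord0)%:R else
   (l == ord0)%:R * - y i1 + (l == i1)%:R * y ord0.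
pose z := \sum_l c l *: x l.
have i1E : (ord0 == i1) = false by apply/eqP => /(congr1 val); rewrite /= inordK.
have sum_c (V : lmodType K) (F : 'I_3 -> V) : \sum_l c l *: F l =
    if y ord0 == 0 then F ord0 else y ord0 *: F i1 - y i1 *: F ord0.
  rewrite /c; case: eqP => _.
    rewrite (bigD1 ord0) //= ?eqxx scale1r big1 ?addr0 // => l /negPf->.
    by rewrite scale0r.
  rewrite (bigD1 ord0) //= ?eqxx i1E mul1r mul0r addr0 (bigD1 i1) /=; last first.
    by rewrite eq_sym i1E.
  rewrite eq_sym i1E ?eqxx mul0r mul1r add0r big1 => [|l /andP[/negPf-> /negPf->]].
    by rewrite addr0 addrC scaleNr.
  by rewrite !mul0r addr0 scale0r.
have z_gr : z \in gr 1 by rewrite memv_suml // => l _; rewrite memvZ ?x_gr.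
have xz0 l : x l * z = 0.
  by rewrite mulr_sumr big1 // => l' _; rewrite -scalerAr xx0 scaler0.
have z0 b : (forall l, x l * b = 0) -> z * b = 0.
  by move=> xb0; rewrite mulr_suml big1 // => l _; rewrite -scalerAl xb0 scaler0.
(* Read in degree k, q is the quotient by v of the form of degree k + 1. Pairing z q with multiples
   of v gives 0 as x_l q = 0 in degree k + 1, and pairing it with u^k gives 0 by the choice of c. *)
have zq0 : z * hform u v k q = 0.
  apply: (@gr_ann0 k.+1) => [||l|r]; first by rewrite def_d; lia.
  - by rewrite -add1n grM ?hform_gr.
  - by rewrite mulrA xz0 mul0r.
  have -> : (d - k.+1 = k)%N by rewrite def_d; lia.
  move=> sz_r; pose r1 := r - r`_k *: 'X^k.
  have sz_r1 : (size r1 <= k)%N.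
    apply/leq_sizeP => j le_kj; rewrite coefB coefZ coefXn.
    have [->|ne_jk] := eqVneq j k; first by rewrite mulr1 subrr.
    rewrite mulr0 subr0 nth_default // (leq_trans sz_r) //.
    by rewrite ltn_neqAle eq_sym ne_jk.
  have -> : r = r`_k *: 'X^k + r1 by rewrite addrC subrK.
  have [b def_b] := v_hform sz_r1.
  rewrite linearD /= def_b mulrDr mulrA -[_ * v]mulrA [_ * v]mulC -hformS //.
  rewrite (z0 _ xq0) mul0r addr0 linearZ -scalerAr linearZ -mulrA.
  rewrite -hformM ?size_polyXn //.
  rewrite addnn mulr_suml linear_sum /=.
  apply/eqP; rewrite mulf_eq0; apply/orP; right.
  under eq_bigr do rewrite -scalerAl linearZ /=.
  by rewrite (sum_c K^o y); case: ifP => // _; rewrite subr_eq0; apply/eqP/mulrC.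
have zf0 : z * hform u v k.+1 f = 0 by apply: z0.
have lev_z : level z d.-1 by rewrite -subn1; apply: gr_level; rewrite // def_d.
have := gcd_ann lev_z sz_f sz_q ndv _ zf0 zq0.
rewrite h0 def_d => /(_ _)/wrap[]; first by lia.
have nz_h : gcdp f q != 0 by rewrite gcdp_eq0 -size_poly_eq0 sz_f.
have /size_poly1P[e nz_e ->] : size (gcdp f q) == 1.
  by rewrite eqn_leq size_poly_gt0 nz_h andbT -subn_eq0 subn1 h0.
rewrite hform0E coefC -scalerAr mulr1 => /eqP; rewrite scaler_eq0 (negPf nz_e).
move/eqP/(ext_free ext) => c0; have := c0 ord0; rewrite /c.
case: ifPn => [_ /eqP|nz_y _]; first by rewrite eqxx oner_eq0.
have := c0 i1; rewrite /c (negPf nz_y) eqxx eq_sym i1E mul0r add0r mul1r.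
by move/eqP; apply/negP.
Qed.

Lemma mulv_inj (s t i : nat) (f g : {poly K}) (a : A) :
    (i.*2.+1 <= d)%N -> (s <= d./2.+1)%N ->
    (forall n, (n < s)%N -> ~~ has_ann_form x n) ->
    size f = s.+1 -> (forall k, x k * hform u v s f = 0) ->
    let z : 'I_1 -> A := fun=> hform u v s f ^+ 2 in
    (forall n, (n < t)%N -> ~~ has_ann_form z n) ->
    size g = t.+1 -> z ord0 * hform u v t g = 0 ->
  a \in gr i -> v * a = 0 -> a = 0.
Proof.
move=> le_id le_sd min_s sz_f xf0 z min_t sz_g zg0 gr_a va0.
set F := hform u v s f in xf0 z min_t zg0 *.
have gr_F : F \in gr s by rewrite hform_gr ?sz_f.
have /grP[b [q [le_b le_q def_a]]] := gr_a.
set N := \sum_k _ in def_a.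
have xN0 k : x k * N = 0.
  by rewrite mulr_sumr big1 // => l _; rewrite mulrA xx0 mul0r.
have FN0 : F * N = 0.
  by rewrite mulr_sumr big1 // => l _; rewrite mulrA [F * _]mulC xf0 mul0r.
have xvq0 k : x k * hform u v i.+1 q = 0.
  have -> : hform u v i.+1 q = v * (a - N) by rewrite hformS // def_a addrC addKr.
  by rewrite mulCA mulrBr xN0 subr0 mulCA va0 mulr0.
have dv_fq : f %| q.
  have [le_si|lt_is] := leqP (s + i.+1) d.
    apply: (@ann_dvdp _ x d.-1 s i.+1) => // [k||]; [|by rewrite ltnW|by lia].
    by apply: x_gr_level; lia.
  (* Now s + i + 1 > d. As v q is in I_(i+1), s <= i + 1, which leaves only d = 2i + 1 and s = i +
     1. *)
  have [->|nz_q] := eqVneq q 0; first exact: dvdp0.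
  have le_si : (s <= i.+1)%N.
    rewrite leqNgt; apply/negP => /min_s/negP[]; apply/has_ann_formP.
    by exists q; split=> //; apply: leqW.
  have [def_d def_s] : d = i.*2.+1 /\ s = i.+1 by lia.
  by move: sz_f xf0 min_s; rewrite /F def_s => *; apply: (@middle_dvdp i).
pose q2 : {poly K} := q %/ f; have def_q : q = f * q2 by rewrite mulrC divpK.
have nz_f : f != 0 by rewrite -size_poly_gt0 sz_f.
have hq n : (size q <= n.+1)%N -> hform u v n q = F * hform u v (n - s) q2.
  move=> le_qn; have [q20|nz_q2] := eqVneq q2 0.
    by rewrite def_q q20 mulr0 !linear0 mulr0.
  have sz_q : size q = (s.+1 + size q2).-1 by rewrite -sz_f -size_mul // -def_q.
  have q2_gt0 : (0 < size q2)%N by rewrite size_poly_gt0.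
  have le_sn : (s <= n)%N by lia.
  by rewrite -[in LHS](subnKC le_sn) def_q hformM ?sz_f //; lia.
have Fa : F * a = F ^+ 2 * hform u v (i - s) q2.
  by rewrite def_a mulrDr FN0 add0r hq // mulrA.
have Fa0 : F * a = 0.
  have [q20|nz_q2] := eqVneq q2 0; first by rewrite Fa q20 linear0 mulr0.
  have sz_q : size q = (s.+1 + size q2).-1 by rewrite -sz_f -size_mul // -def_q.
  have q2_gt0 : (0 < size q2)%N by rewrite size_poly_gt0.
  have zq20 : F ^+ 2 * hform u v (i - s).+1 q2 = 0.
    rewrite hformS //; last by lia.
    by rewrite mulCA -Fa mulCA va0 mulr0.
  have le_ti : (t <= (i - s).+1)%N.
    rewrite leqNgt; apply/negP => /min_t/negP[]; apply/has_ann_formP.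
    by exists q2; split=> //; lia.
  (* The degree bound t + (i - s + 1) <= d - 2s + 1 follows from t <= i - s + 1 and 2i + 1 <= d. *)
  have dv_gq2 : g %| q2.
    apply: (@ann_dvdp _ z (d - s.*2) t (i - s).+1) => // [l||]; try lia.
    apply: gr_level => [||k]; first by lia.
      by rewrite /z -addnn expr2 grM.
    by rewrite /z expr2 mulrA xf0 mul0r.
  pose q3 : {poly K} := q2 %/ g; have def_q2 : q3 * g = q2 by rewrite divpK.
  have nz_q3 : q3 != 0 by apply: contraNneq nz_q2 => q30; rewrite -def_q2 q30 mul0r.
  have nz_g : g != 0 by rewrite -size_poly_gt0 sz_g.
  have sz_q2 : size q2 = (size q3 + t.+1).-1 by rewrite -sz_g -size_mul // def_q2.
  have q3_gt0 : (0 < size q3)%N by rewrite size_poly_gt0.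
  rewrite Fa -def_q2 [q3 * g]mulrC.
  by rewrite (ideal_hform _ (zg0 : F ^+ 2 * _ = 0)) ?sz_g //; lia.
have xa0 k : x k * a = 0.
  by rewrite def_a hq // mulrDr xN0 add0r mulrA xf0 mul0r.
have le_s : (s <= d - i)%N by lia.
apply: (gr_ann0 _ gr_a xa0) => [|p le_p]; first by lia.
(* As f has a nonzero coefficient at u^s, a multiple of f u^(d-i-s) cancels the coefficient of
   u^(d-i) in p; what remains is divisible by v. *)
pose e : K := p`_(d - i) / lead_coef f; pose p1 := p - e *: (f * 'X^(d - i - s)).
have sz_p1 : (size p1 <= d - i)%N.
  apply/leq_sizeP => j le_j; rewrite coefB coefZ coefMXn ltnNge.
  have -> /= : (d - i - s <= j)%N by lia.
  have [->|ne_j] := eqVneq j (d - i)%N.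
    rewrite subKn // /e lead_coefE sz_f divfK ?subrr //.
    by rewrite -[s]/(s.+1.-1) -sz_f -lead_coefE lead_coef_eq0.
  have lt_j : (d - i < j)%N by rewrite ltn_neqAle eq_sym ne_j.
  rewrite (nth_default _ (leq_trans le_p lt_j)) nth_default ?mulr0 ?subrr //.
  by rewrite sz_f; lia.
have [c def_c] := v_hform sz_p1.
have -> : p = p1 + e *: (f * 'X^(d - i - s)) by rewrite subrK.
rewrite linearD linearZ /= def_c mulrDr mulrA [a * v]mulC va0 mul0r add0r.
rewrite -scalerAr (@ideal_hform _ s) ?sz_f ?size_polyXn ?scaler0 ?linear0 //.
  rewrite mulC; exact: Fa0.
lia.
Qed.

(** Upper half: if a of degree d - j - 1 pairs to zero with l gr j, then l a pairs to zero with gr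
    j, so l a = 0 and a = 0. Thus l gr j has at least the dimension of gr (j + 1). *)
Lemma WLP_of_inj l : l \in gr 1 ->
    (forall i a, (i.*2.+1 <= d)%N -> a \in gr i -> l * a = 0 -> a = 0) ->
  WLP gr.
Proof.
move=> gr_l inj; exists l => // j; have [le_jd|lt_dj] := leqP j.*2.+1 d.
  left=> a b gr_a gr_b Eab; apply/eqP; rewrite -subr_eq0; apply/eqP.
  by apply: (inj j); rewrite ?memvB // mulrBr Eab subrr.
right=> b gr_b; have [le_dj|lt_jd] := leqP d j.
  by exists 0; rewrite ?mem0v // mulr0 (gr_gt _ gr_b).
pose f := amull l; have fE c : f c = l * c by rewrite lfunE.
have sub : (f @: gr j <= gr j.+1)%VS.
  by apply/subvP => _ /memv_imgP[c gr_c ->]; rewrite fE -add1n grM.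
suff /eqP Ef : (f @: gr j == gr j.+1)%VS.
  by move: gr_b; rewrite -Ef => /memv_imgP[c gr_c ->]; exists c; rewrite ?fE.
rewrite eqEdim sub /= -[in gr j.+1](subKn lt_jd) dim_gr_sym ?leq_subr //.
apply: (@leq_dim_pairing _ _ phi) => a gr_a fa0.
apply: (inj (d - j.+1)%N) => //; first by lia.
apply: (@gr_nondeg (d - j)%N); first exact: leq_subr.
  by rewrite -subnSK // -add1n grM.
rewrite subKn ?(ltnW lt_jd) // => c gr_c.
by rewrite [l * a]mulC -mulrA fa0 // -fE memv_img.
Qed.

End SquareZeroExtension.

(** * Choice of the linear form, and the equivalence *)

Section Shear.

Variables (K : fieldType) (A : falgType K) (gr : nat -> {vspace A}) (d : nat).
Variables (x : 'I_3 -> A) (phi : {scalar A}).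

Lemma hform_shear_sub (u v : A) c n (p : {poly K}) : GRing.comm u v ->
  hform u v n p = hform u (v - c *: u) n (shear c n p).
Proof.
move=> cuv; rewrite -hform_shear ?subrK //.
by rewrite /GRing.comm mulrBr mulrBl cuv -scalerAl -scalerAr.
Qed.

Lemma ext_shear u v c : square_zero_ext gr d x u v phi ->
  square_zero_ext gr d x u (v - c *: u) phi.
Proof.
case=> mulC xx0 x_free grP nondeg gr_gt; split=> // i a.
have shift w e :
    (exists (b : 'I_3 -> {poly K}) (q : {poly K}),
      [/\ forall k, (size (b k) <= i)%N, (size q <= i.+1)%N
        & a = \sum_k x k * hform u w i.-1 (b k) + hform u w i q]) ->
    exists (b : 'I_3 -> {poly K}) (q : {poly K}),
      [/\ forall k, (size (b k) <= i)%N, (size q <= i.+1)%N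
        & a = \sum_k x k * hform u (w - e *: u) i.-1 (b k)
              + hform u (w - e *: u) i q].
  case=> b [q [le_b le_q ->]].
  exists (fun k => shear e i.-1 (b k)), (shear e i q).
  have cuw : GRing.comm u w by apply: mulC.
  split=> [k||]; last 2 [exact: size_shear].
    have := le_b k; case: (i) => [/size_poly_leq0P->|j _]; last exact: size_shear.
    by rewrite /shear linear0 size_poly0.
  rewrite -hform_shear_sub //; congr (_ + _); apply: eq_bigr => k _.
  by rewrite -hform_shear_sub.
apply: (iff_trans (grP i a)); split=> [|/shift]; first exact: shift.
by move/(_ (- c)); rewrite scaleNr opprK subrK.
Qed.

Lemma has_ann_form_shear u v c m (z : 'I_m -> A) n : GRing.comm u v ->
  has_ann_form u v z n = has_ann_form u (v - c *: u) z n.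
Proof.
move=> cuv; have shift w e : GRing.comm u w ->
    has_ann_form u w z n -> has_ann_form u (w - e *: u) z n.
  move=> cuw /has_ann_formP[p [nz_p le_p zp0]]; apply/has_ann_formP.
  exists (shear e n p); split=> [||t]; first by rewrite shear_eq0.
    exact: size_shear.
  by rewrite -hform_shear_sub.
apply/idP/idP => [|ann]; first exact: shift.
have := shift (v - c *: u) (- c) _ ann; rewrite scaleNr opprK subrK; apply.
by rewrite /GRing.comm mulrBr mulrBl cuv -scalerAl -scalerAr.
Qed.

Hypothesis K_infinite : forall r : {poly K}, r != 0 -> exists c, ~~ root r c.

Lemma WLP_has_ann u v : square_zero_ext gr d x u v phi ->
  has_ann_form u v x d./2.+1 -> WLP gr.
Proof.
move=> ext ann_d; have comm (a b : A) : GRing.comm a b by apply: ext_mulC ext a b.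
have ex_s : exists n, has_ann_form u v x n by exists d./2.+1.
have [s ann_s min_s] := ex_minnP ex_s.
have [f [nz_f le_f xf0]] := has_ann_formP _ _ _ _ ann_s.
pose z : 'I_1 -> A := fun=> hform u v s f ^+ 2.
have ex_t : exists n, has_ann_form u v z n.
  (* In degree d + 1 the polynomial 1 encodes v^(d+1), which vanishes in A. *)
  exists d.+1; apply/has_ann_formP; exists 1.
  rewrite oner_neq0 size_poly1; split=> // t.
  suff -> : hform u v d.+1 1 = 0 by rewrite mulr0.
  by apply: (ext_gr_gt ext (ltnSn d)); rewrite (hform_gr ext) ?size_poly1.
have [t ann_t min_t] := ex_minnP ex_t.
have [g [nz_g le_g zg0]] := has_ann_formP _ _ _ _ ann_t.
have [r1 nz_r1 lead_f] := shear_lead le_f nz_f.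
have [r2 nz_r2 lead_g] := shear_lead le_g nz_g.
(* For this c the linear form v - c u divides neither f nor g. *)
have [|c] := K_infinite (r := r1 * r2); first by rewrite mulf_neq0.
rewrite rootM negb_or => /andP[/lead_f sz_f /lead_g sz_g].
have extc := ext_shear c ext.
have v_gr : v - c *: u \in gr 1.
  by rewrite -(hform1 u (v - c *: u)) (hform_gr extc) ?size_poly1.
apply: (WLP_of_inj ext v_gr) => i a le_id.
apply: (mulv_inj extc (s := s) (t := t) (f := shear c s f) (g := shear c t g)) => //.
- exact: min_s.
- move=> n; rewrite -has_ann_form_shear // ltnNge; exact/contra/min_s.
- by move=> k; rewrite -hform_shear_sub.
- move=> n; rewrite -hform_shear_sub // -has_ann_form_shear // ltnNge.
  exact/contra/min_t.
- by rewrite -!hform_shear_sub // (zg0 ord0).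
Qed.

(** If I has a form of degree d/2 + 1, then h_i = d + 2 forces i and d - i to be at most d/2, so i =
    d/2. Otherwise the consecutive degrees d - d/2 - 1 and d - d/2 both attain d + 2. *)
Lemma ext_WLP u v : (0 < d)%N -> square_zero_ext gr d x u v phi ->
  WLP gr <-> (#|[set i : 'I_d.+1 | \dim (gr i) == d.+2]| <= 1)%N.
Proof.
move=> d_gt0 ext; set S := [set i | _].
have S_mem (i : 'I_d.+1) :
    (i \in S) = ~~ has_ann_form u v x i && ~~ has_ann_form u v x (d - i).
  by rewrite inE (dim_gr_max ext) // -ltnS.
have ann_leq := has_ann_form_leq ext (z := x).
have [ann|no_ann] := boolP (has_ann_form u v x d./2.+1).
  split=> _; last exact: WLP_has_ann ext ann.
  apply/card_le1_eqP => i j.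
  have mid (k : 'I_d.+1) : k \in S -> k = d./2 :> nat.
    rewrite S_mem => /andP[no_k no_dk].
    have lt_k : (k < d./2.+1)%N.
      by rewrite ltnNge; apply: contra no_k => le_k; apply: ann_leq ann.
    have : (d - k < d./2.+1)%N.
      by rewrite ltnNge; apply: contra no_dk => le_k; apply: ann_leq ann.
    lia.
  by move=> /mid Ei /mid Ej; apply: val_inj; rewrite /= Ei Ej.
split=> [/(not_WLP ext no_ann d_gt0)//|/card_le1_eqP S1].
have lt1 : (d - d./2.+1 < d.+1)%N by lia.
have lt2 : (d - d./2 < d.+1)%N by lia.
have S_in (i : 'I_d.+1) : (i <= d./2.+1)%N -> (d - i <= d./2.+1)%N -> i \in S.
  move=> le_i le_di; rewrite S_mem; apply/andP.
  by split; apply: contra no_ann; apply: ann_leq.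
have := S1 (Ordinal lt1) (Ordinal lt2).
rewrite !S_in /=; try lia; move/(_ isT isT)/(congr1 val) => /=; lia.
Qed.

End Shear.

(** * Perazzo algebras *)

Section MacaulayDuality.

Variables (K : fieldType) (n : nat) (d : nat) (F : {mpoly K[n.+1]}) (nzF : F != 0).
Hypothesis F_homog : F \is d.-homog.

Definition residue (a : AF nzF) : K := (mact F (repr a))@_0%MM.

Lemma residue_piAF p : residue (piAF nzF p) = (mact F p)@_0%MM.
Proof.
rewrite /residue; congr (_@__); apply/eqP.
by rewrite -subr_eq0 -(linearB (mact F)) /= -(piAF_eq nzF) /piAF reprK.
Qed.

Lemma residue_is_scalar : scalar residue.
Proof.
move=> c a b; rewrite -[a]reprK -[b]reprK.
rewrite -!/(piAF _ _) -linearP !residue_piAF linearP /=.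
by rewrite mcoeffD mcoeffZ.
Qed.

HB.instance Definition _ :=
  GRing.isLinear.Build K (AF nzF) K *%R residue residue_is_scalar.

Lemma mcoeff_mact_homog i p m : p \is i.-homog -> (mdeg m + i)%N != d ->
  (mact F p)@_m = 0.
Proof.
move=> hp neq_d; rewrite /mact raddf_sum big1_seq //= => m' pm'.
rewrite mcoeffZ mcoeff_mderivm (dhomog_nemf_coeff F_homog) ?mul0rn ?mulr0 //.
by rewrite /= mdegD addnC (dhomog_mf hp pm').
Qed.

Lemma gradAF_gt i : (d < i)%N -> {in gradAF nzF i, forall a, a = 0}.
Proof.
move=> lt_di _ /mem_gradAF[p hp <-]; apply/eqP; rewrite -(linear0 (piAF nzF)).
rewrite piAF_eq subr0; apply/eqP/mpolyP => m; rewrite mcoeff0.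
by apply: (mcoeff_mact_homog hp); lia.
Qed.

(** The constant term of the action of 'X_[m] p on F is the coefficient at m of that of p, times the
    factorials of the exponents of m, nonzero in characteristic zero. *)
Lemma gradAF_nondeg i : [pchar K] =i pred0 -> (i <= d)%N ->
  {in gradAF nzF i, forall a,
    {in gradAF nzF (d - i)%N, forall b, residue (a * b) = 0} -> a = 0}.
Proof.
move=> charK0 le_id _ /mem_gradAF[p hp <-] p0; apply/eqP.
rewrite -(linear0 (piAF nzF)) piAF_eq subr0; apply/eqP/mpolyP => m; rewrite mcoeff0.
have [def_m|ne_m] := eqVneq (mdeg m) (d - i)%N; last first.
  by apply: (mcoeff_mact_homog hp); lia.
have /p0 : piAF nzF 'X_[m] \in gradAF nzF (d - i)%N.
  by apply/mem_gradAF; exists 'X_[m] => //; rewrite dhomogX; apply/eqP.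
rewrite -piAFM residue_piAF mulrC mactM mactX mcoeff_mderivm addm0.
move/eqP; rewrite -mulr_natr mulf_eq0 => /orP[/eqP-> //|].
have := pcharf0P K; case=> /(_ charK0)-> _; rewrite -leqn0 leqNgt prodn_gt0 // => j.
by rewrite ffactnn fact_gt0.
Qed.

End MacaulayDuality.

(** * A_F as a square-zero extension *)

Section PerazzoAlgebra.

Variable K : fieldType.

Notation iU := (@Ordinal 5 3 isT).
Notation iV := (@Ordinal 5 4 isT).

Lemma inUVE (p : {mpoly K[2]}) : inUV p =
  \sum_(m <- msupp p) p@_m *: 'X_[(U_(iU) *+ m ord0 + U_(iV) *+ m ord_max)%MM].
Proof.
rewrite /inUV comp_mpolyEX; apply: eq_bigr => m _; congr (_ *: _).
rewrite comp_mpolyX !big_ord_recl big_ord0 mulr1 mpolyXD !mpolyXn.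
by congr ('X_[_] * 'X_[_]); congr (_ *+ _)%MM; congr (m _); apply: val_inj.
Qed.

Definition ix (k : 'I_3) : 'I_5 := widen_ord (isT : 3 <= 5)%N k.

Lemma mderivXU n (i j : 'I_n) : ('X_i : {mpoly K[n]})^`M(j) = (i == j)%:R.
Proof.
rewrite mderivX mnm1E; case: eqP => [->|_]; last by rewrite scale0r.
by rewrite -{1}[U_(j)%MM]add0m addmK mpolyX0 scale1r.
Qed.

Lemma mderiv_inUV k (p : {mpoly K[2]}) : (inUV p)^`M(ix k) = 0.
Proof.
rewrite inUVE raddf_sum big1 //= => m _; rewrite mderivZ mderivX.
rewrite mnmDE !mulmnE !mnm1E -!val_eqE /=.
by case: k => [[|[|[|k]]] lt_k] //=; rewrite ?(muln0, mul0n) scale0r scaler0.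
Qed.

Lemma inUV_homog e (p : {mpoly K[2]}) : p \is e.-homog -> inUV p \is e.-homog.
Proof.
move=> hp; rewrite inUVE big_seq rpred_sum // => m pm; rewrite rpredZ // dhomogX /=.
rewrite mdegD !mdegMn !mdeg1 !mul1n -(dhomog_mf hp pm) /= mdegE.
by rewrite !big_ord_recl big_ord0 addn0; apply/eqP; congr (_ + _)%N; congr (m _); apply: val_inj.
Qed.

Lemma inUV_eq0 (p : {mpoly K[2]}) : inUV p = 0 -> p = 0.
Proof.
pose ev : 5.-tuple {mpoly K[2]} := [tuple 0; 0; 0; 'X_ord0; 'X_ord_max].
move/(congr1 (fun q => q \mPo ev)); rewrite comp_mpoly0 => <-.
rewrite inUVE linear_sum [LHS]mpolyE; apply: eq_bigr => m _ /=.
rewrite comp_mpolyZ; congr (_ *: _); rewrite mpolyXD -!mpolyXn rmorphM !rmorphXn /=.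
rewrite !comp_mpolyXU /= mpolyXE_id !big_ord_recl big_ord0 mulr1.
by congr ('X_[_] ^+ _ * 'X_[_] ^+ _); congr (m _); apply: val_inj.
Qed.

Variables (d : nat) (F : {mpoly K[5]}).
Hypothesis hF : perazzo d F.

Lemma perazzo_mact : exists2 P : 'I_3 -> {mpoly K[2]},
  forall c : 'I_3 -> K, \sum_k c k *: P k = 0 -> forall k, c k = 0
  & forall k, mact F 'X_(ix k) = inUV (P k).
Proof.
have [p0 [p1 [p2 [G [_ free_p _ ->]]]]] := hF.
exists (fun k => [:: p0; p1; p2]`_k) => [c|k].
  rewrite !big_ord_recl big_ord0 /= addr0 addrA => /free_p[c0 c1 c2].
  by case=> [[|[|[|k]]] lt_k] //;
    [rewrite -[RHS]c0 | rewrite -[RHS]c1 | rewrite -[RHS]c2];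
    congr (c _); apply: val_inj.
have dX (i : 'I_5) (p : {mpoly K[2]}) :
    ('X_i * inUV p)^`M(ix k) = (i == ix k)%:R * inUV p.
  by rewrite mderivM mderiv_inUV mderivXU mulr0 addr0.
rewrite mactX mderivmU1m 3!mderivD !dX mderiv_inUV addr0.
by case: k {dX} => [[|[|[|k]]] lt_k] //=;
  rewrite -?val_eqE /= !mul0r mul1r ?addr0 ?add0r.
Qed.

Lemma perazzo_homog : (0 < d)%N -> F \is d.-homog.
Proof.
move=> d_gt0; have [p0 [p1 [p2 [G [[hp0 hp1 hp2] _ hG ->]]]]] := hF.
have hX (i : 'I_5) (p : {mpoly K[2]}) :
    p \is d.-1.-homog -> 'X_i * inUV p \is d.-homog.
  move=> hp.
  have hXi : ('X_i : {mpoly K[5]}) \is 1.-homog by rewrite dhomogX /= mdeg1.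
  by have := dhomogM hXi (inUV_homog hp); rewrite add1n prednK.
by rewrite !rpredD ?hX ?inUV_homog.
Qed.

Lemma piAFX (nzF : F != 0) (p : {mpoly K[5]}) e :
  piAF nzF (p ^+ e) = piAF nzF p ^+ e.
Proof. by elim: e => [|e IHe]; rewrite ?expr0 ?piAF1 // !exprS piAFM IHe. Qed.

Lemma hform_piAF (nzF : F != 0) (p q : {mpoly K[5]}) e (r : {poly K}) :
  hform (piAF nzF p) (piAF nzF q) e r = piAF nzF (hform p q e r).
Proof.
rewrite /hform linear_sum; apply: eq_bigr => i _ /=.
by rewrite linearZ /= piAFM !piAFX.
Qed.

Lemma hform_homog e (r : {poly K}) :
  hform ('X_iU : {mpoly K[5]}) 'X_iV e r \is e.-homog.
Proof.
rewrite rpred_sum // => i _; rewrite rpredZ // !mpolyXn -mpolyXD dhomogX /=.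
by rewrite mdegD !mdegMn !mdeg1 !mul1n subnKC // -ltnS ltn_ord.
Qed.

Lemma mpolyX_UV (m : 'X_{1..5}) : (forall k, m (ix k) = 0%N) ->
  ('X_[m] : {mpoly K[5]}) = 'X_iU ^+ m iU * 'X_iV ^+ m iV /\
  mdeg m = (m iU + m iV)%N.
Proof.
move=> m0; have m0' (j : 'I_5) : (j < 3)%N -> m j = 0%N.
  by move=> lt_j3; apply: etrans (m0 (Ordinal lt_j3)); congr (m _); apply: val_inj.
rewrite mpolyXE_id mdegE !big_ord_recl !big_ord0 (m0' ord0) //
  (m0' (lift ord0 ord0)) // (m0' (lift ord0 (lift ord0 ord0))) //.
rewrite !expr0 !mul1r mulr1.
have [<- <-] : lift ord0 (lift ord0 (lift ord0 ord0)) = iU /\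
    lift ord0 (lift ord0 (lift ord0 (lift ord0 ord0))) = iV.
  by split; apply: val_inj.
by rewrite addn0 !add0n.
Qed.

(** The action of x_k turns F into p_k, a form in U and V that every x_l kills; so x_k x_l = 0, and
    the x_k are independent because the p_k are. *)
Lemma perazzo_ext : (0 < d)%N -> [pchar K] =i pred0 ->
  let nzF := perazzo_neq0 hF in
  square_zero_ext (gradAF nzF) d (fun k => piAF nzF 'X_(ix k))
    (piAF nzF 'X_iU) (piAF nzF 'X_iV) (@residue K 4 F nzF).
Proof.
move=> d_gt0 charK0 nzF; have F_homog := perazzo_homog d_gt0.
have [P P_free mactP] := perazzo_mact.
have xx0 k l : piAF nzF 'X_(ix k) * piAF nzF 'X_(ix l) = 0.
  apply/eqP; rewrite -piAFM -(linear0 (piAF nzF)) piAF_eq subr0 mactM mactP.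
  by rewrite mactX mderivmU1m mderiv_inUV.
split=> //; first exact: mulrC.
- move=> c; under eq_bigr do rewrite -linearZ; rewrite -linear_sum /= => /eqP.
  rewrite -(linear0 (piAF nzF)) piAF_eq subr0 linear_sum /=.
  under eq_bigr do rewrite mactZ mactP -comp_mpolyZ.
  by rewrite -linear_sum => /eqP/inUV_eq0/P_free.
- move=> i a; split=> [/mem_gradAF[p hp <-]|[b [q [le_b le_q ->]]]].
    pose E a := exists (b : 'I_3 -> {poly K}) (q : {poly K}),
      [/\ forall k, (size (b k) <= i)%N, (size q <= i.+1)%N
        & a = \sum_k piAF nzF 'X_(ix k)
                * hform (piAF nzF 'X_iU) (piAF nzF 'X_iV) i.-1 (b k)
              + hform (piAF nzF 'X_iU) (piAF nzF 'X_iV) i q].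
    have E0 : E 0.
      exists (fun=> 0), 0; split=> [k||]; rewrite ?size_poly0 //.
      by rewrite big1 => [|k _]; rewrite linear0 ?mulr0 ?add0r.
    have E_lin c a1 a2 : E a1 -> E a2 -> E (c *: a1 + a2).
      case=> [b [q [le_b le_q ->]]] [b' [q' [le_b' le_q' ->]]].
      have szZD (r r' : {poly K}) s :
          (size r <= s -> size r' <= s -> size (c *: r + r')%R <= s)%N.
        move=> le_r le_r'; rewrite (leq_trans (size_polyD _ _)) // geq_max le_r'.
        by rewrite (leq_trans (size_scale_leq _ _)).
      exists (fun k => c *: b k + b' k), (c *: q + q').
      split=> [k||]; [exact: szZD | exact: szZD |].
      rewrite linearP scalerDr addrACA; congr (_ + _).
      rewrite scaler_sumr -big_split; apply: eq_bigr => k _ /=.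
      by rewrite linearP mulrDr -scalerAr.
    (* A monomial without x-variables is binary, one with a single x_k lies in (x), and one with two
       or more vanishes. *)
    have E_X m : mdeg m = i -> E (piAF nzF 'X_[m]).
      have [k0 nz_m|m0 def_i] := pickP (fun k => m (ix k) != 0%N); last first.
        have [|-> def_m] := @mpolyX_UV m.
          by move=> k; apply/eqP; rewrite -[_ == _]negbK m0.
        exists (fun=> 0), 'X^(m iU).
        have le_i : (m iU <= i)%N by rewrite -def_i def_m leq_addr.
        split=> [k||]; rewrite ?size_poly0 ?size_polyXn //.
        rewrite big1 ?add0r => [|k _]; last by rewrite linear0 mulr0.
        by rewrite hformXn // -def_i def_m addKn piAFM !piAFX.
      pose m' := (m - U_(ix k0))%MM.
      have def_m : m = (U_(ix k0) + m')%MM.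
        by rewrite addmC submK // lep1mP.
      rewrite def_m mpolyXD piAFM mdegD mdeg1 => def_i.
      have [l nz_m'|m0] := pickP (fun k => m' (ix k) != 0%N).
        have -> : m' = (U_(ix l) + (m' - U_(ix l)))%MM.
          by rewrite addmC submK // lep1mP.
        by rewrite mpolyXD piAFM mulrA xx0 mul0r.
      have [|-> def_m'] := @mpolyX_UV m'.
        by move=> k; apply/eqP; rewrite -[_ == _]negbK m0.
      exists (fun k => if k == k0 then 'X^(m' iU) else 0), 0.
      split=> [k||]; last 1 first.
      - rewrite linear0 addr0 (bigD1 k0) //= eqxx big1 ?addr0 => [|k /negPf->].
          rewrite hformXn -def_i def_m' ?leq_addr // add1n /= addKn.
          by rewrite piAFM !piAFX.
        by rewrite linear0 mulr0.
      - case: ifP; rewrite ?size_poly0 // size_polyXn -def_i def_m' => _.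
        by rewrite add1n ltnS leq_addr.
      - by rewrite size_poly0.
    rewrite -/(E _) [p]mpolyE linear_sum big_seq; elim/big_rec: _ => // m a1 pm Ea1.
    by rewrite linearZ; apply: E_lin => //; apply: E_X; apply: (dhomog_mf hp pm).
  apply/mem_gradAF.
  exists (\sum_k 'X_(ix k) * hform 'X_iU 'X_iV i.-1 (b k) + hform 'X_iU 'X_iV i q).
    rewrite rpredD ?hform_homog // rpred_sum // => k _.
    case: i le_b {le_q} => [|i] le_b.
      by have /size_poly_leq0P-> := le_b k; rewrite linear0 mulr0 rpred0.
    have hXk : ('X_(ix k) : {mpoly K[5]}) \is 1.-homog by rewrite dhomogX /= mdeg1.
    exact: dhomogM hXk (hform_homog _ _).
  rewrite linearD linear_sum /= hform_piAF; congr (_ + _).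
  by apply: eq_bigr => k _; rewrite piAFM hform_piAF.
- by move=> i; apply: gradAF_nondeg.
- exact: gradAF_gt.
Qed.

End PerazzoAlgebra.

Theorem theorem3p11 (K : closedFieldType) (charK0 : [pchar K] =i pred0)
    (d : nat) (le5d : (5 <= d)%N) (F : {mpoly K[5]}) (hF : perazzo d F) :
  WLP (gradAF (perazzo_neq0 hF)) <->
  (#|[set i : 'I_d.+1 | \dim (gradAF (perazzo_neq0 hF) i) == d.+2]| <= 1)%N.
Proof.
have d_gt0 : (0 < d)%N by apply: leq_trans le5d.
apply: (ext_WLP _ d_gt0 (perazzo_ext hF d_gt0 charK0)) => r.
by move/closed_nonrootP.
Qed.
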